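(* Let $\Gamma^*$ be the set of optimal solutions of the linearly scalarized multi-objective multi-robot pickup and delivery problem, over all weights $\boldsymbol{w}\in\mathcal{W}$. Assume that each solution $\boldsymbol{c}^i\in\Gamma^*$ is optimal for some set of weights $\mathcal{W}^i\subseteq\mathcal{W}$ inscribing a ball in $\mathbb{R}^{n-1}$ of radius $r^i>0$ (the dimension is $n-1$ because $\mathcal{W}\subset\mathbb{R}^n$ is constrained by one equality). Then the adaptive sampling algorithm described in the context is complete, i.e. it finds all solutions in $\Gamma^*$ given a sufficiently large but finite sampling budget $K$.
   Context: **Multi-objective multi-robot pickup and delivery (MO-MRPD).** The environment is a weighted graph $G=(V,E,d)$, where $d$ gives the duration of traversing an edge. A fleet of $m$ robots, each of capacity $\kappa$, serves a finite sequence $\mathcal{T}$ of tasks generated by a stochastic process $\mathcal{Y}$. Each task is a tuple $(s,g,t^r,t^d)$ with pickup vertex $s$, drop-off vertex $g$, release time $t^r$ and deadline $t^d>t^r$. A policy $\pi$ assigns each task to exactly one robot and gives each robot a tour on $G$ serving its tasks. There are $n$ bounded positive cost functions, collected in $\boldsymbol{c}(\pi,\mathcal{T})=[c_1(\pi,\mathcal{T}),\dots,c_n(\pi,\mathcal{T})]$. **Scalarization.** The weight space is $\mathcal{W}=\{\boldsymbol{w}\in\mathbb{R}^n_{\ge 0} : \sum_i w_i=1\}$. For $\boldsymbol{w}\in\mathcal{W}$ the scalarized problem is $\min_\pi \boldsymbol{w}\cdot\boldsymbol{c}(\pi,\mathcal{T})$. A solver is given which for each $\boldsymbol{w}$ provides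 a policy $\pi(\boldsymbol{w})$ that solves this problem. The algorithm evaluates policies on a list $\mathcal{I}=\{\mathcal{T}_1,\dots,\mathcal{T}_\eta\}$ of $\eta$ task sequences (training instances) drawn from $\mathcal{Y}$: a solver call $\mathtt{MRPD}(\boldsymbol{w},\mathcal{I})$ returns $\boldsymbol{C}_{\mathcal{I}}(\boldsymbol{w})=\{\boldsymbol{c}(\pi(\boldsymbol{w}),\mathcal{T}_1),\dots,\boldsymbol{c}(\pi(\boldsymbol{w}),\mathcal{T}_\eta)\}$. Let $\boldsymbol{\mu}(\boldsymbol{w})$ be the mean of these $\eta$ cost vectors. ''Solutions'' in $\Gamma^*$ are understood through their costs on the training instances. **Statistical test.** $h(\boldsymbol{w}^i,\boldsymbol{w}^j)=e^{-\mathrm{KL}(\boldsymbol{w}^i\|\boldsymbol{w}^j)}$, where $\mathrm{KL}(\boldsymbol{w}^i\|\boldsymbol{w}^j)$ is the Kullback–Leibler divergence between $\boldsymbol{C}_{\mathcal{I}}(\boldsymbol{w}^i)$ and $\boldsymbol{C}_{\mathcal{I}}(\boldsymbol{w}^j)$. For a threshold $\Delta$, put $H_\Delta(\boldsymbol{w}^i,\boldsymbol{w}^j)=1$ if $h(\boldsymbol{w}^i,\boldsymbol{w}^j)\le\Delta$ and $0$ otherwise. **Adaptive sampling algorithm.** Inputs include the graph, the fleet, the process $\mathcal{Y}$, the cost functions, the policy $\pi(\boldsymbol{w})$, the sampling budget $K$, the number $\eta$ of training instances and the overlap threshold $\Delta$. The algorithm maintains a set $\Omega$ of weights, a set $\Gamma$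 of their costs, and a collection $\mathcal{S}$ of simplexes, each given by a tuple of $n$ weights (its vertices). An edge of a simplex is an unordered pair of its vertices. 1. Draw $\mathcal{I}$ from $\mathcal{Y}$. Initialize $\Omega=\{\boldsymbol{e}^1,\dots,\boldsymbol{e}^n\}$ (standard basis of $\mathbb{R}^n$), $\Gamma=\{\boldsymbol{C}_{\mathcal{I}}(\boldsymbol{e}^1),\dots,\boldsymbol{C}_{\mathcal{I}}(\boldsymbol{e}^n)\}$, $\mathcal{S}=\{(\boldsymbol{e}^1,\dots,\boldsymbol{e}^n)\}$. 2. For $k=n,\dots,K$: - (Find_New_Weight) Among all edges $(\boldsymbol{w}^i,\boldsymbol{w}^j)$ of simplexes in $\mathcal{S}$, pick one maximizing the discounted pair-wise dispersion $$D((\boldsymbol{w}^i,\boldsymbol{w}^j))=\frac{H_\Delta(\boldsymbol{w}^i,\boldsymbol{w}^j)}{2^{\alpha((\boldsymbol{w}^i,\boldsymbol{w}^j))}}\,\|\boldsymbol{\mu}(\boldsymbol{w}^i)-\boldsymbol{\mu}(\boldsymbol{w}^j)\|,$$ and let $\boldsymbol{w}'$ be its midpoint. Here $\alpha((\boldsymbol{w}^i,\boldsymbol{w}^j))$ counts how often Find_New_Weight previously returned the midpoint of some edge $(\boldsymbol{w}^l,\boldsymbol{w}^p)$ with the same mean costs, $(\boldsymbol{\mu}(\boldsymbol{w}^l),\boldsymbol{\mu}(\boldsymbol{w}^p))=(\boldsymbol{\mu}(\boldsymbol{w}^i),\boldsymbol{\mu}(\boldsymbol{w}^j))$. - Compute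 $\boldsymbol{C}_{\mathcal{I}}(\boldsymbol{w}')$. - (Update) For every $s\in\mathcal{S}$ whose convex hull contains $\boldsymbol{w}'$: find the vertices $\boldsymbol{w}^i,\boldsymbol{w}^j$ of $s$ of which $\boldsymbol{w}'$ is the midpoint, remove $s$ from $\mathcal{S}$, and add the two simplexes obtained from $s$ by replacing $\boldsymbol{w}^i$ by $\boldsymbol{w}'$ and by replacing $\boldsymbol{w}^j$ by $\boldsymbol{w}'$, respectively. Then, if $h(\boldsymbol{w}',\boldsymbol{w})\le\Delta$ for all $\boldsymbol{w}\in\Omega$, add $\boldsymbol{w}'$ to $\Omega$ and $\boldsymbol{C}_{\mathcal{I}}(\boldsymbol{w}')$ to $\Gamma$. 3. Return $\Omega,\Gamma$.
   Formalization: Added, since the claim fails otherwise: distinct solutions in Γ* have overlap h at most Δ; ties are broken fairly (an edge maximizing D infinitely often is eventually picked); each leg of a tour between consecutive stops repeats no vertex, which makes Γ* finite. *)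

(* Defs.v *)
(* MathComp-Analysis. *)
From HB Require Import structures.
From mathcomp Require Import all_boot all_order all_algebra.
From mathcomp Require Import all_classical all_reals all_analysis.

Set Implicit Arguments.
Unset Strict Implicit.
Unset Printing Implicit Defensive.

Import Order.TTheory GRing.Theory Num.Theory.

Local Open Scope classical_set_scope.
Local Open Scope ring_scope.

Record wgraph (R : realType) := WGraph {
  vertex : finType;
  edge : rel vertex;
  duration : vertex -> vertex -> R;
  duration_ge0 : forall u v, edge u v -> 0 <= duration u v }.

Record task (R : realType) (G : wgraph R) := Task {
  pickup : vertex G;
  dropoff : vertex G;
  release : R;
  deadline : R;
  release_deadline : release < deadline }.

(* The stop [inl k] picks up task number k of the sequence, [inr k] drops it
   off. *)
Definition stop (R : realType) (G : wgraph R) (T : seq (task G)) : finType :=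
  ('I_(size T) + 'I_(size T))%type.

Definition stop_vertex (R : realType) (G : wgraph R) (T : seq (task G))
    (e : stop T) : vertex G :=
  match e with
  | inl k => pickup (tnth (in_tuple T) k)
  | inr k => dropoff (tnth (in_tuple T) k)
  end.

(* A tour is a starting vertex followed by legs; the leg (p, e) travels along
   the vertices p (the current vertex excluded) and ends with the stop e. *)
Definition tour (R : realType) (G : wgraph R) (T : seq (task G)) : Type :=
  (vertex G * seq (seq (vertex G) * stop T))%type.

(* The route between two consecutive stops is a path in the sense of graph
   theory, i.e. it repeats no vertex (the whole tour may). *)
Fixpoint travels (R : realType) (G : wgraph R) (T : seq (task G))
    (x : vertex G) (legs : seq (seq (vertex G) * stop T)) : bool :=
  if legs is (p, e) :: legs' then
    [&& path (@edge R G) x p, uniq (x :: p), last x p == stop_vertex e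
      & travels (last x p) legs']
  else true.

Definition stops (R : realType) (G : wgraph R) (T : seq (task G))
    (t : tour T) : seq (stop T) := unzip2 t.2.

Definition is_pickup (R : realType) (G : wgraph R) (T : seq (task G))
    (e : stop T) : bool := if e is inl _ then true else false.

(* The tour t serves exactly the tasks of A with a vehicle of capacity kappa. *)
Definition serves (R : realType) (G : wgraph R) (T : seq (task G))
    (kappa : nat) (A : {set 'I_(size T)}) (t : tour T) : Prop :=
  [/\ travels t.1 t.2,
      uniq (stops t),
      forall k, ((inl k : stop T) \in stops t) = (k \in A) /\
                ((inr k : stop T) \in stops t) = (k \in A),
      forall k, k \in A ->
        (index (inl k : stop T) (stops t) < index (inr k : stop T) (stops t))%N
    & forall j, (count (@is_pickup R G T) (take j (stops t)) <=
        kappa + count (predC (@is_pickup R G T)) (take j (stops t)))%N].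

(* What a policy does on one task sequence. *)
Record plan (R : realType) (G : wgraph R) (m : nat) (T : seq (task G)) := Plan {
  assign : {ffun 'I_(size T) -> 'I_m};
  tours : {ffun 'I_m -> tour T} }.

Definition feasible (R : realType) (G : wgraph R) (m kappa : nat)
    (T : seq (task G)) (p : plan m T) : Prop :=
  forall r : 'I_m, serves kappa [set k | assign p k == r]%SET (tours p r).

(* [process] is the random task sequence on the sample space [outcome].  The
   completeness of the algorithm is claimed for every outcome of the draws, so
   that no probability law on [outcome] is recorded. *)
Record mrpd (R : realType) (n : nat) := MRPD {
  graph : wgraph R;
  fleet : nat;
  capacity : nat;
  outcome : Type;
  process : outcome -> seq (task graph);
  cost : 'I_n -> forall T : seq (task graph), plan fleet T -> R;
  cost_gt0 : forall i T (p : plan fleet T),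
    feasible capacity p -> 0 < cost i p;
  cost_bounded : forall i, exists M, forall T (p : plan fleet T),
    feasible capacity p -> cost i p <= M }.

Definition policy (R : realType) (n : nat) (P : mrpd R n) : Type :=
  forall T : seq (task (graph P)), plan (fleet P) T.

Definition admissible (R : realType) (n : nat) (P : mrpd R n)
    (pi : policy P) : Prop :=
  forall o : outcome P, feasible (capacity P) (pi (process o)).

Definition cost_vector (R : realType) (n : nat) (P : mrpd R n)
    (pi : policy P) (T : seq (task (graph P))) : 'rV[R]_n :=
  \row_i cost i (pi T).

Definition dot (R : realType) (n : nat) (u v : 'rV[R]_n) : R :=
  \sum_i u 0 i * v 0 i.

Definition enorm (R : realType) (n : nat) (u : 'rV[R]_n) : R :=
  Num.sqrt (\sum_i u 0 i ^+ 2).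

Definition weights (R : realType) (n : nat) : set 'rV[R]_n :=
  [set w | (forall i, 0 <= w 0 i) /\ \sum_i w 0 i = 1].

Definition solves (R : realType) (n : nat) (P : mrpd R n) (w : 'rV[R]_n)
    (T : seq (task (graph P))) (pi : policy P) : Prop :=
  admissible pi /\
  forall pi' : policy P, admissible pi' ->
    dot w (cost_vector pi T) <= dot w (cost_vector pi' T).

Definition solver_correct (R : realType) (n : nat) (P : mrpd R n)
    (sol : 'rV[R]_n -> policy P) : Prop :=
  forall w, weights w -> forall o : outcome P, solves w (process o) (sol w).

(* The cost vectors on the eta training instances. *)
Definition costs (R : realType) (n eta : nat) : Type :=
  {ffun 'I_eta -> 'rV[R]_n}.

Definition training_costs (R : realType) (n eta : nat) (P : mrpd R n)
    (omega : 'I_eta -> outcome P) (pi : policy P) : costs R n eta :=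
  [ffun l => cost_vector pi (process (omega l))].

Definition optimal_for (R : realType) (n eta : nat) (P : mrpd R n)
    (omega : 'I_eta -> outcome P) (c : costs R n eta) (w : 'rV[R]_n) : Prop :=
  exists pi : policy P,
    (forall l, solves w (process (omega l)) pi) /\ c = training_costs omega pi.

Definition optimal_solutions (R : realType) (n eta : nat) (P : mrpd R n)
    (omega : 'I_eta -> outcome P) : set (costs R n eta) :=
  [set c | exists2 w, weights w & optimal_for omega c w].

(* A ball of the hyperplane sum_i w_i = 1, which is isometric to R^(n-1). *)
Definition inscribes_ball (R : realType) (n : nat) (A : set 'rV[R]_n)
    (r : R) : Prop :=
  exists2 x : 'rV[R]_n, \sum_i x 0 i = 1 &
    forall w : 'rV[R]_n, \sum_i w 0 i = 1 -> enorm (w - x) < r -> A w.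

Definition mean (R : realType) (n eta : nat) (C : costs R n eta) : 'rV[R]_n :=
  (eta%:R)^-1 *: \sum_l C l.

(* The empirical distribution of a sample. *)
Definition empirical (R : realType) (n eta : nat) (C : costs R n eta)
    (x : 'rV[R]_n) : R :=
  #|[set l | C l == x]%SET|%:R / eta%:R.

(* Kullback-Leibler divergence of the empirical distributions; it is +oo
   without absolute continuity. *)
Definition KL (R : realType) (n eta : nat) (C C' : costs R n eta) : \bar R :=
  (\sum_(x <- undup (codom C))
     (if empirical C' x == 0%R then +oo
      else (empirical C x * ln (empirical C x / empirical C' x))%:E))%E.

Definition overlap (R : realType) (n eta : nat) (C C' : costs R n eta)
    : \bar R := expeR (- KL C C')%E.

Definition distinct (R : realType) (n eta : nat) (Delta : R)
    (C C' : costs R n eta) : bool := (overlap C C' <= Delta%:E)%E.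

Definition simplex (R : realType) (n : nat) : Type :=
  {ffun 'I_n -> 'rV[R]_n}.

Definition hull (R : realType) (n : nat) (s : simplex R n) : set 'rV[R]_n :=
  [set \sum_i l 0 i *: s i | l in @weights R n].

Definition midpoint (R : realType) (n : nat) (x : 'rV[R]_n * 'rV[R]_n)
    : 'rV[R]_n := 2^-1 *: (x.1 + x.2).

Definition replace (R : realType) (n : nat) (s : simplex R n) (i : 'I_n)
    (w : 'rV[R]_n) : simplex R n :=
  [ffun j => if j == i then w else s j].

(* [returned] lists the edges whose midpoints Find_New_Weight has returned. *)
Record state (R : realType) (n eta : nat) := State {
  Omega : set 'rV[R]_n;
  Gamma : set (costs R n eta);
  simplexes : set (simplex R n);
  returned : seq ('rV[R]_n * 'rV[R]_n) }.

(* An unordered edge is represented by both of its orientations, as the overlap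
   is not symmetric. *)
Definition is_edge (R : realType) (n : nat) (S : set (simplex R n))
    (x : 'rV[R]_n * 'rV[R]_n) : Prop :=
  exists s i j, [/\ S s, i != j & x = (s i, s j)].

Definition same_edge (R : realType) (n : nat) (x y : 'rV[R]_n * 'rV[R]_n)
    : bool := (x == y) || (x == (y.2, y.1)).

(* In what follows C w stands for the costs returned by the solver call on w. *)

Definition mean_edge (R : realType) (n eta : nat)
    (C : 'rV[R]_n -> costs R n eta) (x : 'rV[R]_n * 'rV[R]_n)
    : 'rV[R]_n * 'rV[R]_n := (mean (C x.1), mean (C x.2)).

Definition alpha (R : realType) (n eta : nat) (C : 'rV[R]_n -> costs R n eta)
    (st : state R n eta) (x : 'rV[R]_n * 'rV[R]_n) : nat :=
  count (fun y => same_edge (mean_edge C y) (mean_edge C x)) (returned st).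

Definition dispersion (R : realType) (n eta : nat) (Delta : R)
    (C : 'rV[R]_n -> costs R n eta) (st : state R n eta)
    (x : 'rV[R]_n * 'rV[R]_n) : R :=
  (distinct Delta (C x.1) (C x.2))%:R / 2 ^+ alpha C st x
  * enorm (mean (C x.1) - mean (C x.2)).

Definition max_edge (R : realType) (n eta : nat) (Delta : R)
    (C : 'rV[R]_n -> costs R n eta) (st : state R n eta)
    (x : 'rV[R]_n * 'rV[R]_n) : Prop :=
  is_edge (simplexes st) x /\
  forall y, is_edge (simplexes st) y ->
    dispersion Delta C st y <= dispersion Delta C st x.

Definition bisect (R : realType) (n : nat) (S : set (simplex R n))
    (w : 'rV[R]_n) : set (simplex R n) :=
  [set t | (S t /\ ~ hull t w) \/
     exists s i j, [/\ S s, hull s w, i != j,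
       w = midpoint (s i, s j) & t = replace s i w \/ t = replace s j w]].

Definition initial (R : realType) (n eta : nat)
    (C : 'rV[R]_n -> costs R n eta) : state R n eta :=
  let e i : 'rV[R]_n := delta_mx 0 i in
  State (range e) (range (C \o e)) [set [ffun i => e i]] [::].

Definition next (R : realType) (n eta : nat) (Delta : R)
    (C : 'rV[R]_n -> costs R n eta) (st : state R n eta)
    (x : 'rV[R]_n * 'rV[R]_n) : state R n eta :=
  let w' := midpoint x in
  let new := [set w | w = w' /\
                forall v, Omega st v -> distinct Delta (C w') (C v)] in
  State (Omega st `|` new) (Gamma st `|` C @` new)
        (bisect (simplexes st) w') (x :: returned st).

(* An execution without budget: x k is the edge picked in iteration k (counted
   from 0) and st k the state before that iteration. *)
Definition execution (R : realType) (n eta : nat) (Delta : R)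
    (C : 'rV[R]_n -> costs R n eta) (st : nat -> state R n eta)
    (x : nat -> 'rV[R]_n * 'rV[R]_n) : Prop :=
  st 0%N = initial C /\
  forall k, max_edge Delta C (st k) (x k) /\
            st k.+1 = next Delta C (st k) (x k).

(* Edges with the same mean costs have the same dispersion, whatever has been
   picked before, so ties never disappear.  Tie-breaking is fair if it does not
   pass over forever an edge that is again and again among the maximizers. *)
Definition fair (R : realType) (n eta : nat) (Delta : R)
    (C : 'rV[R]_n -> costs R n eta) (st : nat -> state R n eta)
    (x : nat -> 'rV[R]_n * 'rV[R]_n) : Prop :=
  forall y k0,
    (forall k1, exists2 k, (k1 <= k)%N & max_edge Delta C (st k) y) ->
    exists2 k, (k0 <= k)%N & same_edge (x k) y.

(* The iterations k = n, ..., K are K + 1 - n in number. *)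
Definition returned_costs (R : realType) (n eta : nat)
    (st : nat -> state R n eta) (K : nat) : set (costs R n eta) :=
  Gamma (st (K.+1 - n)%N).

(* Main.v *)
(* Suppose that a solution [c] is never found, and let [B] be an open ball of
   weights for which [c] is optimal; every weight of [B] has the costs [c], so
   that no vertex ever lies in [B].  The simplexes form a simplicial complex at
   any time.  Among all faces, of all simplexes at all times, that meet [B],
   consider one with the fewest vertices, and fix affinely independent points in
   its intersection with [B].  When an edge of this face is bisected, the common
   face of the two halves does not meet [B], by minimality, so one half contains
   all the fixed points, and the determinant of their barycentric coordinates
   doubles.  As this determinant is bounded, the face eventually stays the same.
   Its vertices do not all have the same costs, for these would then be optimal
   in a point of [B], by convexity; hence it has an edge of positive dispersion.
   Since there are finitely many costs, the dispersion of the picked edges would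
   tend to 0 if this edge were a maximizer only finitely often.  By fairness it
   is picked, a contradiction. *)
Require Import Defs.
From mathcomp Require Import all_boot all_order all_algebra.
From mathcomp Require Import all_classical all_reals all_analysis.
From mathcomp Require Import perm ring lra.

Set Implicit Arguments.
Unset Strict Implicit.
Unset Printing Implicit Defensive.

Import Order.TTheory GRing.Theory Num.Theory.

Local Open Scope classical_set_scope.
Local Open Scope ring_scope.

(** * Finiteness of the set of optimal solutions *)

Lemma finite_range (T : finType) (U : Type) (f : T -> U) : finite_set (range f).
Proof. exact: finite_image. Qed.

(** A route repeats no vertex, so it has at most [#|vertex G|] vertices and is a value of a finite
    type. *)
Lemma travels_sizeP (R : realType) (G : wgraph R) (T : seq (task G))
    (x : vertex G) (legs : seq (seq (vertex G) * stop T)) :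
  travels x legs ->
  exists legs' : seq (#|vertex G|.-bseq (vertex G) * stop T),
    legs = [seq (val q.1, q.2) | q <- legs'].
Proof.
elim: legs x => [|[p e] legs IH] x /=; first by exists [::].
case/and4P=> _ /andP[_ up] _ /IH[legs' ->].
have szp : (size p <= #|vertex G|)%N by rewrite -(card_uniqP up) max_card.
by exists ((Bseq szp, e) :: legs').
Qed.

Definition tour_code (R : realType) (G : wgraph R) (T : seq (task G))
    : finType :=
  (vertex G * #|stop T|.-bseq (#|vertex G|.-bseq (vertex G) * stop T))%type.

Definition decode_tour {R : realType} {G : wgraph R} {T : seq (task G)}
    (t : tour_code T) : tour T :=
  (t.1, [seq (val q.1, q.2) | q <- val t.2]).

(** The stops of a serving tour are pairwise different, which bounds the number of legs. *)
Lemma serves_decode (R : realType) (G : wgraph R) (T : seq (task G))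
    (kappa : nat) (A : {set 'I_(size T)}) (t : tour T) :
  serves kappa A t -> exists u : tour_code T, t = decode_tour u.
Proof.
case: t => v legs [/= tr us _ _ _].
have [legs' Elegs] := travels_sizeP tr.
have sz : (size legs' <= #|stop T|)%N.
  move: us; rewrite /stops /unzip2 /= Elegs -map_comp => us.
  by move/card_uniqP: us; rewrite size_map => <-; apply: max_card.
by exists (v, Bseq sz); rewrite /decode_tour /= Elegs.
Qed.

(** Policies may be infinite in number, but the costs on [T] depend only on the plan for [T], and
    feasible plans are decoded from a finite type. *)
Lemma finite_feasible_cost (R : realType) (n : nat) (P : mrpd R n)
    (T : seq (task (graph P))) :
  finite_set [set v : 'rV[R]_n | exists2 pi : policy P,
     feasible (capacity P) (pi T) & v = cost_vector pi T].
Proof.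
pose code : finType := ({ffun 'I_(size T) -> 'I_(fleet P)} *
  {ffun 'I_(fleet P) -> tour_code T})%type.
pose decode (u : code) : 'rV[R]_n :=
  \row_i cost i (Plan u.1 [ffun r => decode_tour (u.2 r)]).
apply: sub_finite_set (finite_range decode) => v [pi fpi ->].
have /fin_all_exists[u Eu] r :
    exists u : tour_code T, tours (pi T) r = decode_tour u.
  exact: serves_decode (fpi r).
exists (assign (pi T), [ffun r => u r]) => //.
apply/rowP=> i; rewrite !mxE /=; congr cost.
case: (pi T) Eu => a t /= Eu; congr Plan.
by apply/ffunP=> r; rewrite !ffunE Eu.
Qed.

Lemma finite_ffun (I : finType) (T : choiceType) (A : I -> set T) :
  (forall i, finite_set (A i)) ->
  finite_set [set f : {ffun I -> T} | forall i, A i (f i)].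
Proof.
move=> fA.
have /fin_all_exists[s Es] i : exists s : seq T, A i = [set` s].
  exact/finite_seqP.
pose D : finType := {dffun forall i : I, seq_sub (s i)}.
apply: sub_finite_set (finite_range (fun g : D => [ffun i => val (g i)])) => f Af.
have Af' i : f i \in s i by move: (Af i); rewrite Es.
exists ([ffun i => SeqSub (Af' i)] : D) => //.
by apply/ffunP=> i; rewrite !ffunE.
Qed.

Lemma finite_optimal_solutions (R : realType) (n eta : nat) (P : mrpd R n)
    (omega : 'I_eta -> outcome P) : finite_set (optimal_solutions omega).
Proof.
have := @finite_ffun 'I_eta 'rV[R]_n _
  (fun l => @finite_feasible_cost R n P (process (omega l))).
apply: sub_finite_set => c [w _ [pi [spi ->]]] l.
by exists pi; rewrite ?ffunE //; case: (spi l).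
Qed.

(** * Sup-norm balls in the hyperplane of coordinate sum 1 *)

Section Box.
Context {R : realType} {n : nat}.
Implicit Types (u v w p z x : 'rV[R]_n) (d : R).

(* The norm of matrices is the sup norm. *)
Definition box x d : set 'rV[R]_n :=
  [set w : 'rV[R]_n | \sum_i w 0 i = 1 /\ `|w - x| < d].

Lemma entry_le_norm u i : `|u 0 i| <= `|u|.
Proof.
rewrite [leRHS]/Num.norm /= mx_normrE.
by apply/bigmax_geP; right => /=; exists (0, i).
Qed.

Lemma weights_norm w : weights w -> `|w| <= 1.
Proof.
move=> [w0 w1]; rewrite /Num.norm /= mx_normrE; apply/bigmax_leP.
split=> // -[i j] _ /=; rewrite ord1 ger0_norm // -w1 (bigD1 j) //= lerDl.
exact: sumr_ge0.
Qed.

Lemma inscribed_box (A : set 'rV[R]_n) (r : R) :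
  0 < r -> inscribes_ball A r ->
  exists x d, [/\ 0 < d, \sum_i x 0 i = 1 & box x d `<=` A].
Proof.
(* The squared Euclidean norm is at most n times the squared sup norm, and n < (n + 1)^2; the
   divisor is positive even for n = 0. *)
move=> r0 [x x1 xA]; exists x, (r / n.+1%:R); split => //.
  by rewrite divr_gt0 // ltr0n.
move=> w [w1 wx]; apply: xA => //.
have d0 : 0 < r / n.+1%:R by rewrite divr_gt0 // ltr0n.
have rE : r = Num.sqrt (r ^+ 2) by rewrite sqrtr_sqr gtr0_norm.
rewrite rE /enorm ltr_sqrt ?exprn_gt0 //.
apply: (@le_lt_trans _ _ (\sum_(i < n) (r / n.+1%:R) ^+ 2)).
  apply: ler_sum => i _; rewrite -[(w - x) 0 i ^+ 2]real_normK ?num_real //.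
  rewrite lerXn2r ?nnegrE ?(ltW d0) //.
  exact: le_trans (entry_le_norm _ _) (ltW wx).
rewrite sumr_const card_ord expr_div_n -mulrnAr gtr_pMr ?exprn_gt0 //.
rewrite -mulr_natr mulrC ltr_pdivrMr ?exprn_gt0 ?ltr0n // mul1r.
by rewrite -natrX ltr_nat; rewrite expnS expn1 mulSn; apply: leq_addr.
Qed.

Lemma box_segment x d p q (t : R) : 0 <= t <= 1 ->
  box x d p -> box x d q -> box x d ((1 - t) *: p + t *: q).
Proof.
move=> /andP[t0 t1] [p1 px] [q1 qx]; split.
  under eq_bigr do rewrite !mxE.
  by rewrite big_split /= -!mulr_sumr p1 q1 !mulr1 subrK.
have -> : (1 - t) *: p + t *: q - x = (1 - t) *: (p - x) + t *: (q - x).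
  by apply/rowP => i; rewrite !mxE; ring.
apply: le_lt_trans (ler_normD _ _) _; rewrite !normrZ.
rewrite (ger0_norm t0) ger0_norm ?subr_ge0 //.
have [->|tn0] := eqVneq t 0; first by rewrite subr0 mul1r mul0r addr0.
have t0' : 0 < t by rewrite lt0r tn0.
nra.
Qed.

(** One [e] works for all [z], since weights are bounded. Negative [t] serve [dot_eq0], and [e < 1]
    serves [det0_tracked]. *)
Lemma box_open x d p : box x d p ->
  exists e : R, [/\ 0 < e, e < 1 & forall z t, weights z -> `|t| <= e ->
    box x d (p + t *: (z - p))].
Proof.
move=> [p1 px]; pose M := 1 + `|p|.
have M0 : 0 < M by rewrite /M ltr_wpDr.
pose e0 := (d - `|p - x|) / (2 * M).
have e00 : 0 < e0 by rewrite divr_gt0 ?subr_gt0 // mulr_gt0.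
exists (Num.min (2^-1) e0); split.
- by rewrite lt_min e00 invr_gt0 ltr0n.
- by rewrite gt_min; apply/orP; left; lra.
move=> z t zW; rewrite le_min => /andP[_ te].
have [_ z1] := zW; split.
  under eq_bigr do rewrite !mxE.
  rewrite big_split /= -mulr_sumr big_split /= sumrN z1 p1 subrr mulr0 addr0 //.
rewrite addrAC; apply: le_lt_trans (ler_normD _ _) _; rewrite normrZ.
have zp : `|z - p| <= M.
  by apply: le_trans (ler_normB _ _) _; rewrite lerD2r weights_norm.
have : `|t| * `|z - p| <= e0 * M by rewrite ler_pM.
suff : e0 * M < d - `|p - x| by lra.
rewrite /e0 invfM mulrA -mulrA mulVf ?gt_eqF // mulr1.
by rewrite ltr_pdivrMr // ltr_pMr ?subr_gt0 // ltrDl.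
Qed.

Lemma delta_weights (i : 'I_n) : weights (delta_mx 0 i : 'rV[R]_n).
Proof.
split=> [j|]; first by rewrite mxE ler0n.
rewrite (bigD1 i) //= mxE !eqxx big1 ?addr0 // => j /negbTE ji.
by rewrite mxE ji andbF.
Qed.

Lemma dotDl u v w : dot (u + v) w = dot u w + dot v w.
Proof. by rewrite /dot -big_split; apply: eq_bigr => i _; rewrite mxE mulrDl. Qed.

Lemma dotZl a u w : dot (a *: u) w = a * dot u w.
Proof. by rewrite /dot mulr_sumr; apply: eq_bigr => i _; rewrite mxE mulrA. Qed.

Lemma dotBl u v w : dot (u - v) w = dot u w - dot v w.
Proof. by rewrite dotDl -scaleN1r dotZl mulN1r. Qed.

Lemma dotBr u v w : dot w (u - v) = dot w u - dot w v.
Proof.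
by rewrite /dot -sumrB; apply: eq_bigr => i _; rewrite !mxE mulrBr.
Qed.

Lemma dot_suml (I : finType) (f : I -> 'rV[R]_n) w :
  dot (\sum_i f i) w = \sum_i dot (f i) w.
Proof.
by rewrite /dot exchange_big; apply: eq_bigr => i _; rewrite summxE mulr_suml.
Qed.

(** A small step from the zero [w] towards a basis vector, or away from it, changes the linear form
    by a positive, respectively negative, multiple of [u 0 i]; neither change may be negative. *)
Lemma dot_eq0 x d u w : (forall v, box x d v -> 0 <= dot v u) ->
  box x d w -> dot w u = 0 -> u = 0.
Proof.
move=> u0 wB wu; apply/rowP => i; rewrite mxE.
have [e [e0 e1 eB]] := box_open wB.
have di := delta_weights i.
have du : dot (delta_mx 0 i) u = u 0 i.
  rewrite /dot (bigD1 i) //= mxE !eqxx mul1r big1 ?addr0 // => j /negbTE ji.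
  by rewrite mxE ji andbF mul0r.
have := u0 _ (eB _ e di _); have := u0 _ (eB _ (- e) di _).
rewrite normrN gtr0_norm // => /(_ (lexx _)) + /(_ (lexx _)).
rewrite !dotDl !dotZl !dotBl wu du; nra.
Qed.

End Box.

(** * Weights for which given costs are optimal *)

Section Optimality.
Context {R : realType} {n eta : nat} {P : mrpd R n}.
Variable omega : 'I_eta -> outcome P.
Implicit Types (c : costs R n eta) (w x : 'rV[R]_n).

Lemma optimal_dot c c' w w' l : optimal_for omega c w ->
  optimal_for omega c' w' -> dot w (c l) <= dot w (c' l).
Proof.
move=> [pi [spi ->]] [pi' [spi' ->]]; rewrite !ffunE.
by have [_] := spi l; apply; case: (spi' l).
Qed.

(** For fixed costs, optimality is a family of inequalities linear in the weight. The policies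
    attaining [c] may vary with i, but their cost vectors on the training instances agree, so any
    one of them serves for the combination. *)
Lemma optimal_convex c (I : finType) (l : I -> R) (s : I -> 'rV[R]_n) :
  (forall i, 0 <= l i) -> \sum_i l i = 1 ->
  (forall i, l i != 0 -> optimal_for omega c (s i)) ->
  optimal_for omega c (\sum_i l i *: s i).
Proof.
move=> l0 l1 copt.
have [i li] : exists i, l i != 0.
  apply: contrapT => /forallNP li0; move: l1; rewrite big1; last first.
    by move=> i _; apply/eqP; apply: contraT => /li0.
  by move/eqP; rewrite eq_sym oner_eq0.
have [pi [spi Ec]] := copt i li.
exists pi; split=> // k; split=> [|pi' api']; first by case: (spi k).
rewrite !dot_suml ler_sum // => j _; rewrite !dotZl.
have [->|lj] := eqVneq (l j) 0; first by rewrite !mul0r.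
have [pij [spij Ecj]] := copt j lj.
rewrite ler_wpM2l //.
have -> : cost_vector pi (process (omega k)) = cost_vector pij (process (omega k)).
  by have := congr1 (fun f : costs R n eta => f k) Ecj; rewrite Ec !ffunE.
by case: (spij k) => _; apply.
Qed.

Lemma optimal_unique c c' x d w : box x d `<=` optimal_for omega c ->
  box x d w -> optimal_for omega c' w -> c' = c.
Proof.
move=> cB wB c'w; apply/ffunP => l; apply/eqP; rewrite -subr_eq0; apply/eqP.
apply: (@dot_eq0 _ _ x d _ w) => // [v vB|].
  by rewrite dotBr subr_ge0; apply: optimal_dot c'w; apply: cB.
rewrite dotBr; apply/eqP; rewrite subr_eq0 eq_le.
by rewrite !(@optimal_dot _ _ w w) //; apply: cB.
Qed.

(** As [c] is optimal on every instance separately, each [c' k - c k] pairs with the centre to a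
    nonnegative number. Equal means make these numbers sum to 0, so each is 0 and [dot_eq0]
    applies. *)
Lemma mean_inj c c' x d w' : (0 < eta)%N -> 0 < d -> \sum_i x 0 i = 1 ->
  box x d `<=` optimal_for omega c -> optimal_for omega c' w' ->
  mean c = mean c' -> c = c'.
Proof.
move=> eta0 d0 x1 cB c'w' /(scalerI _); rewrite invr_eq0 pnatr_eq0 -lt0n.
move=> /(_ eta0) Ecc'; apply/esym/ffunP => l.
apply/eqP; rewrite -subr_eq0; apply/eqP.
have xB : box x d x by split; rewrite ?subrr ?normr0.
have ge0 v k : box x d v -> 0 <= dot v (c' k - c k).
  by move=> vB; rewrite dotBr subr_ge0; apply: optimal_dot c'w'; apply: cB.
apply: (@dot_eq0 _ _ x d _ x) => // [v|]; first exact: ge0.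
apply/eqP; move: l (isT).
have : \sum_k dot x (c' k - c k) = 0.
  transitivity (dot x (\sum_k (c' k - c k))).
    rewrite /dot exchange_big; apply: eq_bigr => i _.
    by rewrite summxE mulr_sumr.
  by rewrite sumrB Ecc' subrr /dot big1 // => i _; rewrite mxE mulr0.
move/eqP; rewrite psumr_eq0; last by move=> k _; apply: ge0.
by move/allP => H l _; apply: H; rewrite mem_index_enum.
Qed.

End Optimality.

(** * Bisection of simplicial complexes *)

Section Complex.
Context {R : realType} {n : nat}.
Implicit Types (s t : simplex R n) (w a b : 'rV[R]_n) (l m : 'I_n -> R).
Implicit Type S : set (simplex R n).

Definition convex_coef l : Prop := (forall i, 0 <= l i) /\ \sum_i l i = 1.

Lemma hullP s w :
  hull s w <-> exists2 l, convex_coef l & w = \sum_i l i *: s i.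
Proof.
split=> [[l lW <-]|[l [l0 l1] ->]]; first by exists (l 0).
exists (\row_i l i); last by apply: eq_bigr => i _; rewrite mxE.
by split=> [i|]; [rewrite mxE | under eq_bigr do rewrite mxE].
Qed.

Lemma weights_convex (I : finType) (l : I -> R) (s : I -> 'rV[R]_n) :
  (forall i, 0 <= l i) -> \sum_i l i = 1 -> (forall i, weights (s i)) ->
  weights (\sum_i l i *: s i).
Proof.
move=> l0 l1 sW; split=> [k|].
  by rewrite summxE sumr_ge0 // => i _; rewrite mxE mulr_ge0 //; case: (sW i).
under eq_bigr do rewrite summxE.
rewrite exchange_big -l1; apply: eq_bigr => i _ /=.
under eq_bigr do rewrite mxE.
by rewrite -mulr_sumr; case: (sW i) => _ ->; rewrite mulr1.
Qed.

(** Barycentric coordinates of the midpoint of the vertices i and j. *)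
Definition half (i j k : 'I_n) : R := if (k == i) || (k == j) then 2^-1 else 0.

Lemma sum_half (V : lmodType R) (F : 'I_n -> V) i j : i != j ->
  \sum_k half i j k *: F k = 2^-1 *: (F i + F j).
Proof.
move=> ij; rewrite (bigD1 i) //= (bigD1 j) ?(eq_sym j) //= big1.
  by rewrite /half !eqxx orbT /= addr0 -scalerDr.
by move=> k /andP[/negbTE ki /negbTE kj]; rewrite /half ki kj scale0r.
Qed.

Lemma half_coef i j : i != j -> convex_coef (half i j).
Proof.
move=> ij; split=> [k|]; first by rewrite /half; case: ifP.
have := sum_half (fun=> 1 : R^o) ij; rewrite /GRing.scale /=.
by under eq_bigr do rewrite mulr1; move=> ->; field.
Qed.

Lemma midpointC a b : midpoint (a, b) = midpoint (b, a).
Proof. by rewrite /midpoint addrC. Qed.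

Lemma hull_midpoint s i j : i != j -> hull s (midpoint (s i, s j)).
Proof.
by move=> ij; apply/hullP; exists (half i j); [exact: half_coef|rewrite sum_half].
Qed.

(* A point with barycentric coordinates [l] in [replace s i w], where [w] is the
   midpoint of [s i] and [s j], has coordinates [unreplaced l i j] in [s]. *)
Definition unreplaced l (i j k : 'I_n) : R :=
  if k == i then l i / 2 else if k == j then l j + l i / 2 else l k.

Lemma unreplaced_coef l i j : i != j -> convex_coef l ->
  convex_coef (unreplaced l i j).
Proof.
move=> ij [l0 l1]; split=> [k|].
  by rewrite /unreplaced; case: ifP => _; [|case: ifP => _];
    rewrite ?addr_ge0 ?divr_ge0.
rewrite -l1 (bigD1 i) //= (bigD1 j) ?(eq_sym j) //= [RHS](bigD1 i) //=.
rewrite [in RHS](bigD1 j) ?(eq_sym j) //= /unreplaced !eqxx eq_sym (negbTE ij).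
rewrite (eq_bigr l) => [|k /andP[/negbTE -> /negbTE ->] //]; by field.
Qed.

(** The last summand vanishes if [F] is the identity and [w] the midpoint. For arbitrary [F], as in
    [conforming], it is the bend at [w] of the piecewise linear extension. *)
Lemma sum_unreplaced (V : lmodType R) (F : 'rV[R]_n -> V) s l i j w : i != j ->
  \sum_k unreplaced l i j k *: F (s k) =
  \sum_k l k *: F (replace s i w k)
  + l i *: (2^-1 *: (F (s i) + F (s j)) - F w).
Proof.
move=> ij; rewrite (bigD1 i) //= (bigD1 j) ?(eq_sym j) //= [in RHS](bigD1 i) //=.
rewrite [in RHS](bigD1 j) ?(eq_sym j) //= !ffunE /unreplaced !eqxx.
rewrite (eq_sym j i) (negbTE ij).
rewrite (eq_bigr (fun k => l k *: F (replace s i w k))); last first.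
  by move=> k /andP[/negbTE ki /negbTE kj]; rewrite ffunE ki kj.
set X := \sum_(k < n | _) _.
rewrite scalerBr scalerA [in RHS]scalerDr scalerDl.
set W := l i *: F w; apply: (addIr W).
rewrite -[RHS]addrA subrK.
by rewrite [LHS](AC ((1*(2*1))*1) ((5*(2*4))*(1*3))).
Qed.

(* The coordinates in [replace s j w] of a point with coordinates [l] in [s]. *)
Definition replaced l (i j k : 'I_n) : R :=
  if k == i then l i - l j else if k == j then 2 * l j else l k.

Lemma unreplacedK l i j : i != j -> unreplaced (replaced l i j) j i =1 l.
Proof.
move=> ij k; rewrite /unreplaced /replaced !eqxx !(eq_sym j i) (negbTE ij).
case: eqP => [->|kj]; first by field.
by case: eqP => [->|] //; field.
Qed.

Lemma sum_replaced s l i j : i != j ->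
  \sum_k replaced l i j k *: replace s j (midpoint (s i, s j)) k =
  \sum_k l k *: s k.
Proof.
move=> ij; have ji : j != i by rewrite eq_sym.
have := sum_unreplaced id s (replaced l i j) (midpoint (s i, s j)) ji.
under eq_bigr do rewrite unreplacedK //.
by move=> ->; rewrite /midpoint /= (addrC (s j)) subrr scaler0 addr0.
Qed.

Lemma replaced_coef l i j : i != j -> l j <= l i -> convex_coef l ->
  convex_coef (replaced l i j).
Proof.
move=> ij lij [l0 l1]; split=> [k|].
  rewrite /replaced; case: ifP => _; first by rewrite subr_ge0.
  by case: ifP => _ //; rewrite mulr_ge0.
rewrite -l1 (bigD1 i) //= (bigD1 j) ?(eq_sym j) //= [RHS](bigD1 i) //=.
rewrite [in RHS](bigD1 j) ?(eq_sym j) //= /replaced !eqxx eq_sym (negbTE ij).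
rewrite (eq_bigr l) => [|k /andP[/negbTE -> /negbTE ->] //]; by ring.
Qed.

(** Test function for [conforming] that reads off the coordinate at the vertex [v]. *)
Definition is_at (v w : 'rV[R]_n) : R := (w == v)%:R.

Lemma sum_is_at s l i : injective s -> \sum_k l k * is_at (s i) (s k) = l i.
Proof.
move=> sI; rewrite (bigD1 i) //= /is_at eqxx mulr1 big1 ?addr0 // => k ki.
by rewrite (inj_eq sI) (negbTE ki) mulr0.
Qed.

Lemma sum_is_at0 s l v : (forall k, s k <> v) -> \sum_k l k * is_at v (s k) = 0.
Proof.
by move=> sv; rewrite big1 // => k _; rewrite /is_at (introF eqP (@sv k)) mulr0.
Qed.

(* Functions on the vertices extend piecewise linearly to the union of the
   simplexes; equivalently, the simplexes form a simplicial complex. *)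
Definition conforming S : Prop := forall s t l m, S s -> S t ->
  convex_coef l -> convex_coef m -> \sum_i l i *: s i = \sum_i m i *: t i ->
  forall F : 'rV[R]_n -> R, \sum_i l i * F (s i) = \sum_i m i * F (t i).

Definition complex S : Prop :=
  [/\ forall s, S s -> forall i, weights (s i),
      forall s, S s -> injective s & conforming S].

(** If [a] were not a vertex of [s], the test function [is_at a] would give 0 at the midpoint in
    [s], but not in a simplex with the edge (a, b); likewise for [b]. *)
Lemma hull_edge S s a b : complex S -> is_edge S (a, b) -> S s ->
  hull s (midpoint (a, b)) -> exists i j, [/\ i != j, s i = a & s j = b].
Proof.
move=> [_ SI SC] [t [i [j [St ij [Ea Eb]]]]] Ss /hullP[l lC].
rewrite Ea Eb /midpoint /= -(@sum_half _ t _ _ ij) => /esym Emid.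
have H v : \sum_k l k * is_at v (s k) = 2^-1 * (is_at v (t i) + is_at v (t j)).
  rewrite (SC _ _ _ _ Ss St lC (half_coef ij) Emid (is_at v)).
  exact: (@sum_half R^o).
have Ha : exists k, s k = a.
  apply: contrapT => /forallNP na; have := H a; rewrite sum_is_at0 // Ea.
  by rewrite /is_at eqxx; case: (_ == _); rewrite /=; lra.
have Hb : exists k, s k = b.
  apply: contrapT => /forallNP nb; have := H b; rewrite sum_is_at0 // Eb.
  by rewrite /is_at eqxx; case: (_ == _); rewrite /=; lra.
have [[p pa] [q qb]] := (Ha, Hb); exists p, q; rewrite -Ea -Eb; split=> //.
apply: contra_neq ij => pq; apply: (SI _ St).
by rewrite -Ea -Eb -pa -qb pq.
Qed.

(** The coordinates of the common midpoint, read off by [is_at], determine the pair of vertices, so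
    Update has no choice but their order. *)
Lemma midpoint_edge S s i j a b : complex S -> is_edge S (a, b) -> S s ->
  i != j -> midpoint (a, b) = midpoint (s i, s j) ->
  (s i = a /\ s j = b) \/ (s i = b /\ s j = a).
Proof.
move=> SK ab Ss ij Emid.
have [p [q [pq pa qb]]] : exists i j, [/\ i != j, s i = a & s j = b].
  by apply: (hull_edge SK) => //; rewrite Emid; apply: hull_midpoint.
have [_ SI SC] := SK.
have H v : 2^-1 * (is_at v (s i) + is_at v (s j)) =
           2^-1 * (is_at v (s p) + is_at v (s q)).
  have := SC _ _ _ _ Ss Ss (half_coef ij) (half_coef pq) _ (is_at v).
  rewrite (@sum_half R^o (fun k => is_at v (s k))) //.
  rewrite (@sum_half R^o (fun k => is_at v (s k))) //; apply.
  by rewrite !sum_half // pa qb; move: Emid; rewrite /midpoint /= => ->.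
have sI := SI _ Ss; have ji : (j == i) = false by rewrite eq_sym (negbTE ij).
have Hi : (p == i) || (q == i).
  apply: contraT; rewrite negb_or => /andP[/negbTE pi /negbTE qi].
  have := H (s i); rewrite /is_at eqxx !(inj_eq sI) ji pi qi /=.
  by clear; lra.
have Hj : (p == j) || (q == j).
  apply: contraT; rewrite negb_or => /andP[/negbTE pj /negbTE qj].
  have := H (s j); rewrite /is_at eqxx !(inj_eq sI) (negbTE ij) pj qj /=.
  by clear; lra.
rewrite -pa -qb; case/orP: Hi => /eqP Ei; case/orP: Hj => /eqP Ej.
- by move: ij; rewrite -Ei -Ej eqxx.
- by left; rewrite Ei Ej.
- by right; rewrite Ei Ej.
- by move: ij; rewrite -Ei -Ej eqxx.
Qed.

Lemma bisectP S a b t : complex S -> is_edge S (a, b) ->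
  bisect S (midpoint (a, b)) t ->
  (S t /\ ~ hull t (midpoint (a, b))) \/
  exists s i j, [/\ S s, i != j, midpoint (a, b) = midpoint (s i, s j),
    (s i = a /\ s j = b) \/ (s i = b /\ s j = a)
    & t = replace s i (midpoint (a, b))].
Proof.
move=> SK ab [|[s [i [j [Ss _ ij Emid tE]]]]]; first by left.
have sij := midpoint_edge SK ab Ss ij Emid.
right; case: tE => ->; first by exists s, i, j.
exists s, j, i; split=> //; rewrite ?(eq_sym j) //; first by rewrite Emid midpointC.
by case: sij => -[]; [right|left].
Qed.

(* A simplex of the bisection does not have both vertices [a] and [b]; hence the
   coordinate of a point at the midpoint is determined by those at [a] and [b]
   before the bisection. *)
Lemma bisect_coef S a b t l : complex S -> is_edge S (a, b) ->
  bisect S (midpoint (a, b)) t -> convex_coef l ->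
  exists s m, let c := 2 * Num.min (\sum_k m k * is_at a (s k))
                                   (\sum_k m k * is_at b (s k)) in
  [/\ S s, convex_coef m & forall (V : lmodType R) (F : 'rV[R]_n -> V),
     \sum_k m k *: F (s k) = \sum_k l k *: F (t k)
       + c *: (2^-1 *: (F a + F b) - F (midpoint (a, b)))].
Proof.
move=> SK ab tB lC; have [l0 _] := lC.
have X0 s m v : convex_coef m -> 0 <= \sum_k m k * is_at v (s k).
  by move=> [m0 _]; rewrite sumr_ge0 // => k _; rewrite mulr_ge0 // ler0n.
have [_ SI _] := SK.
case: (bisectP SK ab tB) => [[St tw]|[s [i [j [Ss ij Emid sij tE]]]]].
  exists t, l => c; split=> // V F; rewrite {}/c.
  (* A simplex that is kept lacks [a] or [b], as otherwise it would contain their midpoint; so one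
     of the two coordinates is 0. *)
  suff -> : Num.min (\sum_k l k * is_at a (t k)) (\sum_k l k * is_at b (t k)) = 0.
    by rewrite mulr0 scale0r addr0.
  have [[i ti]|/forallNP na] := pselect (exists i, t i = a); last first.
    by rewrite (sum_is_at0 _ na) min_l // X0.
  have [[j tj]|/forallNP nb] := pselect (exists j, t j = b); last first.
    by rewrite (sum_is_at0 _ nb) min_r // X0.
  case: tw; rewrite -ti -tj; apply: hull_midpoint.
  have [u [p [q [Su pq [pa qb]]]]] := ab.
  apply: contra_neq pq => Eij; apply: (SI _ Su).
  by rewrite -pa -qb -ti -tj Eij.
exists s, (unreplaced l i j) => c; split=> //; first exact: unreplaced_coef.
move=> V F; rewrite {}/c (sum_unreplaced F s l (midpoint (a, b)) ij) -tE.
have sI := SI _ Ss; have ji : (j == i) = false by rewrite eq_sym (negbTE ij).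
suff -> : 2 * Num.min (\sum_k unreplaced l i j k * is_at a (s k))
    (\sum_k unreplaced l i j k * is_at b (s k)) = l i.
  by case: sij => -[-> ->]; rewrite // (addrC (F b)).
have lj := l0 j.
case: sij => -[<- <-]; rewrite !sum_is_at // /unreplaced !eqxx ji.
  by rewrite min_l; [field | rewrite lerDr].
by rewrite min_r; [field | rewrite lerDr].
Qed.

(** By [bisect_coef], sums over vertices before and after the bisection differ by a term that
    depends only on the old coordinates at [a] and [b], and these do not depend on the simplex. *)
Lemma complex_bisect S a b : complex S -> is_edge S (a, b) ->
  complex (bisect S (midpoint (a, b))).
Proof.
move=> SK ab; have [SW SI SC] := SK.
(* The midpoint is a new vertex, so that the vertices of each half stay distinct. *)
have wN s k : S s -> s k <> midpoint (a, b).
  move=> Ss sk.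
  have kC : convex_coef (fun i => (i == k)%:R : R).
    split=> [p|]; first exact: ler0n.
    by rewrite (bigD1 k) //= eqxx big1 ?addr0 // => p /negbTE ->.
  have [|i [j [ij ia jb]]] := hull_edge SK ab Ss.
    rewrite -sk; apply/hullP; exists (fun i => (i == k)%:R) => //.
    rewrite (bigD1 k) //= eqxx big1 ?addr0 ?scale1r // => i /negbTE ->.
    by rewrite scale0r.
  have sI := SI _ Ss.
  have Es : \sum_p (p == k)%:R *: s p = \sum_p half i j p *: s p.
    rewrite sum_half // (bigD1 k) //= eqxx scale1r big1 ?addr0 => [|p /negbTE ->].
      by rewrite sk ia jb.
    by rewrite scale0r.
  have := SC _ _ _ _ Ss Ss kC (half_coef ij) Es (is_at (s k)).
  rewrite (@sum_half R^o (fun p => is_at (s k) (s p))) // sum_is_at // eqxx.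
  rewrite /is_at !(inj_eq sI) /GRing.scale /=.
  have [ik|_] := eqVneq i k; have [jk|_] := eqVneq j k; rewrite /=; try by clear; lra.
  by move: ij; rewrite ik jk eqxx.
split.
- move=> t tB i.
  case: (bisectP SK ab tB) => [[St _]|[s [p [q [Ss pq -> _ ->]]]]]; first exact: SW.
  rewrite ffunE; case: eqP => _; last exact: SW.
  rewrite /midpoint /= -sum_half //; have [h0 h1] := half_coef pq.
  by apply: weights_convex => // k; apply: SW.
- move=> t tB.
  case: (bisectP SK ab tB) => [[St _]|[s [p [q [Ss pq _ _ ->]]]]]; first exact: SI.
  move=> i j; rewrite !ffunE; case: eqP => [->|_]; case: eqP => [->|_] //.
  + by move=> /esym /(wN _ _ Ss).
  + by move=> /(wN _ _ Ss).
  + exact: SI.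
- move=> s t l m sB tB lC mC E F.
  have [s' [l' [Ss' lC' Hs]]] := bisect_coef SK ab sB lC.
  have [t' [m' [St' mC' Ht]]] := bisect_coef SK ab tB mC.
  have E' : \sum_k l' k *: s' k = \sum_k m' k *: t' k.
    by rewrite (Hs _ id) (Ht _ id) /= E /midpoint /= subrr !scaler0.
  have H := SC _ _ _ _ Ss' St' lC' mC' E'.
  have := Hs R^o F; have := Ht R^o F; rewrite /GRing.scale /= !H.
  by move=> -> /addIr.
Qed.

Lemma bisect_kept S s w : S s -> ~ hull s w -> bisect S w s.
Proof. by left. Qed.

Lemma bisect_replace S s i j : S s -> i != j ->
  bisect S (midpoint (s i, s j)) (replace s j (midpoint (s i, s j))).
Proof.
move=> Ss ij; right; exists s, i, j; split=> //; last by right.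
exact: hull_midpoint.
Qed.

Lemma complex_initial :
  complex [set [ffun i : 'I_n => delta_mx 0 i : 'rV[R]_n] : simplex R n].
Proof.
have sumE (l : 'I_n -> R) i : (\sum_k l k *:
    [ffun i : 'I_n => delta_mx 0 i : 'rV[R]_n] k) 0 i = l i.
  rewrite summxE (bigD1 i) //= ffunE !mxE !eqxx mulr1 big1 ?addr0 // => k ki.
  by rewrite ffunE !mxE eq_sym (negbTE ki) andbF mulr0.
split.
- by move=> s -> i; rewrite ffunE; apply: delta_weights.
- move=> s -> i j; rewrite !ffunE => /matrixP/(_ 0 j); rewrite !mxE !eqxx /=.
  by case: eqP => [->|_] // /eqP; rewrite eq_sym oner_eq0.
- move=> s t l m -> -> _ _ E F; apply: eq_bigr => i _.
  by rewrite -(sumE l) -(sumE m) E.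
Qed.

End Complex.

(** * Determinants of barycentric coordinates under bisection *)

Section Determinant.
Context {R : realType} {n : nat}.

(** For i != j, right multiplication by this matrix subtracts column j from column i and doubles
    column j, as [replaced] does with coordinates. *)
Definition transvect (i j : 'I_n) : 'M[R]_n :=
  \matrix_(k, p) ((k == p)%:R + (k == j)%:R * ((p == j)%:R - (p == i)%:R)).

Lemma mulmx_transvect (L : 'M[R]_n) i j r k : i != j ->
  (L *m transvect i j) r k = replaced (L r) i j k.
Proof.
move=> ij; rewrite mxE.
transitivity (L r k + L r j * ((k == j)%:R - (k == i)%:R)).
  under eq_bigr do rewrite mxE mulrDr.
  rewrite big_split /=; congr (_ + _).
    rewrite (bigD1 k) //= eqxx mulr1 big1 ?addr0 // => p /negbTE ->.
    by rewrite mulr0.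
  rewrite (bigD1 j) //= eqxx mul1r big1 ?addr0 // => p /negbTE ->.
  by rewrite mul0r mulr0.
rewrite /replaced; have [->|ki] := eqVneq k i.
  by rewrite (negbTE ij) sub0r mulrN1.
have [->|kj] := eqVneq k j; first by rewrite subr0 mulr1 mulr_natl mulr2n.
by rewrite subr0 mulr0 addr0.
Qed.

Lemma det_transvect i j : i != j -> \det (transvect i j) = 2.
Proof.
move=> ij.
(* Row j of [transvect i j] is twice row j of the identity minus row i of the identity. The matrix
   [C] has that row i also in place j, so its determinant is 0. *)
pose C : 'M[R]_n := \matrix_(k, p) (if k == j then (i == p)%:R else (k == p)%:R).
rewrite (@determinant_multilinear _ _ _ 1%:M C j 2 (-1)).
- rewrite det1 (@determinant_alternate _ _ C i j) // => [|p].
    by rewrite mulr0 addr0 mulr1.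
  by rewrite !mxE eqxx; case: eqP => // <-.
- apply/rowP => p; rewrite !mxE eqxx mul1r mulN1r (eq_sym i) (eq_sym j p).
  by ring.
- apply/matrixP => k p; rewrite !mxE [lift _ _ == j]eq_sym.
  by rewrite (negbTE (neq_lift _ _)) ?mul0r ?addr0.
- apply/matrixP => k p; rewrite !mxE [lift _ _ == j]eq_sym.
  by rewrite (negbTE (neq_lift _ _)) ?mul0r ?addr0.
Qed.

Lemma det_bound (L : 'M[R]_n) : (forall i j, 0 <= L i j <= 1) ->
  `|\det L| <= (n`!)%:R.
Proof.
move=> L01; apply: le_trans (ler_norm_sum _ _ _) _.
rewrite -card_Sn -sum1_card natr_sum; apply: ler_sum => s _.
rewrite normrM normrX normrN1 expr1n mul1r normr_prod prodr_ile1 // => i _.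
by have /andP[L0 L1] := L01 i (s i); rewrite normr_ge0 ger0_norm.
Qed.

End Determinant.

(** * Fixed points of a face, followed through the bisections *)

Section Tracking.
Context {R : realType} {n : nat}.
Variables (B : set 'rV[R]_n) (J : {set 'I_n}) (q : 'I_n -> 'rV[R]_n).
Implicit Types (S : set (simplex R n)) (s : simplex R n) (L : 'M[R]_n).

Hypothesis B_convex : forall p p' t, 0 <= t <= 1 -> B p -> B p' ->
  B ((1 - t) *: p + t *: p').
Hypothesis qB : forall r, r \in J -> B (q r).

Definition supported (A : {set 'I_n}) (l : 'I_n -> R) : Prop :=
  convex_coef l /\ forall j, j \notin A -> l j = 0.

(* The rows outside [J] only serve to make [L] a square matrix. *)
Definition tracked S s L : Prop :=
  [/\ S s,
      forall r, r \in J -> supported J (L r) /\ q r = \sum_j L r j *: s j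
    & forall r, r \notin J -> forall j, L r j = (r == j)%:R].

Definition no_smaller_face S : Prop := forall s l (A : {set 'I_n}),
  S s -> supported A l -> (#|A| < #|J|)%N -> ~ B (\sum_j l j *: s j).

(** The points [q r] are the vertices of the face shrunk towards its point [p], hence affinely
    independent. *)
Lemma det0_tracked S s p e l : S s -> supported J l ->
  p = \sum_j l j *: s j -> 0 < e -> e < 1 ->
  (forall r, r \in J -> q r = p + e *: (s r - p)) ->
  exists2 L, tracked S s L & \det L != 0.
Proof.
move=> Ss [[l0 l1] lJ] pE e0 e1 qE.
pose L : 'M[R]_n := \matrix_(r, j)
  ((r \in J)%:R * ((1 - e) * l j + e * (r == j)%:R)
   + (r \notin J)%:R * (r == j)%:R).
have sum1 r (F : 'I_n -> R) : \sum_j (r == j)%:R * F j = F r.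
  rewrite (bigD1 r) //= eqxx mul1r big1 ?addr0 // => j /negbTE.
  by rewrite eq_sym => ->; rewrite mul0r.
exists L.
  split=> // r rJ; last by move=> j; rewrite mxE rJ (negbTE rJ) mul0r add0r mul1r.
  have LE j : L r j = (1 - e) * l j + e * (r == j)%:R.
    by rewrite mxE rJ mul1r mul0r addr0.
  split; first split; first split.
  - move=> j; rewrite LE addr_ge0 // mulr_ge0 ?ler0n ?subr_ge0 // ltW //.
  - under eq_bigr do rewrite LE.
    rewrite big_split /= -!mulr_sumr l1.
    under [X in _ + _ * X]eq_bigr do rewrite -[(r == _)%:R]mulr1.
    by rewrite (sum1 r (fun=> 1)) !mulr1 subrK.
  - move=> j jJ; rewrite LE lJ // mulr0 add0r.
    by case: eqP jJ => [<-|_]; [rewrite rJ | rewrite mulr0].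
  - rewrite qE //; under eq_bigr do rewrite LE scalerDl -!scalerA.
    rewrite big_split /= -!scaler_sumr -pE (bigD1 r) //= eqxx scale1r.
    rewrite big1 ?addr0 => [|j /negbTE]; last by rewrite eq_sym => ->; rewrite scale0r.
    by rewrite scalerBr scalerBl scale1r addrA addrAC.
(* A left kernel vector [v] vanishes outside [J]. Summing its equations over [J] gives [m = 0],
   because the [l j] sum to 1, and then [v = 0]. *)
apply/negP => /det0P[v /negP v0 vL]; apply: v0; apply/eqP.
pose m := \sum_(r in J) v 0 r.
have vLE j : (j \in J) -> (1 - e) * l j * m + e * v 0 j = 0.
  move=> jJ; have /rowP/(_ j) := vL; rewrite !mxE => <-.
  rewrite /m mulr_sumr big_mkcond [X in _ + X = _](_ : _ =
    \sum_r (r == j)%:R * (e * v 0 j)); last first.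
    rewrite -mulr_suml (bigD1 j) //= eqxx big1 ?addr0 ?mul1r // => r /negbTE -> //.
  rewrite -big_split; apply: eq_bigr => r _ /=; rewrite mxE.
  case: ifP => rJ; last first.
    case: eqP rJ => [->|_ rJ]; first by rewrite jJ.
    by rewrite /=; ring.
  by case: eqP => [->|_] /=; ring.
have vN j : j \notin J -> v 0 j = 0.
  move=> jJ; have /rowP/(_ j) := vL; rewrite !mxE => <-.
  rewrite (bigD1 j) //= big1 ?addr0.
    by rewrite mxE eqxx jJ (negbTE jJ) !mulr1 mul0r add0r mulr1.
  by move=> r /negbTE rj; rewrite mxE rj lJ // !(mulr0, addr0).
have sumlJ : \sum_(j in J) l j = 1.
  rewrite -l1 [RHS](bigID (mem J)) /= [X in _ = _ + X]big1 ?addr0 //.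
have m0 : m = 0.
  have : \sum_(j in J) ((1 - e) * l j * m + e * v 0 j) = 0.
    by rewrite big1 // => j jJ; apply: vLE.
  rewrite big_split /= -mulr_suml -!mulr_sumr sumlJ -/m => H; lra.
apply/rowP => j; rewrite mxE.
have [jJ|jJ] := boolP (j \in J); last exact: vN.
have /eqP := vLE _ jJ; rewrite m0 mulr0 add0r mulf_eq0 gt_eqF //=.
by move/eqP.
Qed.

Lemma tracked_outside S s L i j : tracked S s L -> injective s -> i != j ->
  j \notin J -> let w := midpoint (s i, s j) in
  exists s', [/\ tracked (bisect S w) s' L, {in J, s' =1 s}
   & forall p r, p \in J -> r \in J -> p != r ->
       ~~ same_edge (s i, s j) (s p, s r)].
Proof.
move=> [Ss LJ LN] sI ij jJ w; exists (replace s j w).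
have s's k : k \in J -> replace s j w k = s k.
  by move=> kJ; rewrite ffunE; case: eqP kJ jJ => [-> ->|].
split=> //.
  split=> //; first exact: bisect_replace.
  move=> r rJ; have [[lC lN] ->] := LJ r rJ; split=> //.
  apply: eq_bigr => k _; have [kJ|kJ] := boolP (k \in J); first by rewrite s's.
  by rewrite lN // !scale0r.
move=> p r pJ rJ pr; apply/negP => /orP[] /eqP[].
  by move=> _ /sI Ej; rewrite Ej rJ in jJ.
by move=> _ /sI Ej; rewrite Ej pJ in jJ.
Qed.

(** All points lie in the half that keeps vertex i, where their coordinates are multiplied by
    [transvect i j]. *)
Lemma tracked_inside S s L i j : tracked S s L -> i != j ->
  i \in J -> j \in J -> (forall r, r \in J -> L r j <= L r i) ->
  exists s' L', tracked (bisect S (midpoint (s i, s j))) s' L' /\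
    `|\det L'| = 2 * `|\det L|.
Proof.
move=> [Ss LJ LN] ij iJ jJ Lij.
exists (replace s j (midpoint (s i, s j))), (L *m transvect i j); split; last first.
  by rewrite det_mulmx det_transvect // normrM mulrC ger0_norm.
split; first exact: bisect_replace.
  move=> r rJ; have [[lC lN] ->] := LJ r rJ.
  have -> : (L *m transvect i j) r = replaced (L r) i j.
    by apply/funext => k; rewrite mulmx_transvect.
  rewrite sum_replaced //; split=> //; split; first exact: replaced_coef (Lij r rJ) lC.
  move=> k kJ; rewrite /replaced; case: eqP kJ => [->|_]; first by rewrite iJ.
  by case: eqP => [->|_]; [rewrite jJ | apply: lN].
move=> r rJ k; rewrite mulmx_transvect // -LN // /replaced.
have rN p : p \in J -> L r p = 0.
  by move=> pJ; rewrite LN //; case: eqP rJ => [->|//]; rewrite pJ.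
case: eqP => [->|_]; first by rewrite !rN // subr0.
by case: eqP => [->|_] //; rewrite !rN // mulr0.
Qed.

(** Two points strictly on opposite sides are joined by a segment in [B] that crosses the common
    face of the two halves, which has one vertex fewer. *)
Lemma tracked_side S s L i j : tracked S s L -> i != j -> i \in J -> j \in J ->
  no_smaller_face (bisect S (midpoint (s i, s j))) ->
  (forall r, r \in J -> L r j <= L r i) \/ (forall r, r \in J -> L r i <= L r j).
Proof.
move=> [Ss LJ LN] ij iJ jJ Smin.
apply: contrapT => /not_orP[/existsNP[r /not_implyP[rJ /negP rij]]].
move=> /existsNP[r' /not_implyP[r'J /negP r'ij]].
rewrite -!ltNge in rij r'ij.
pose d := L r j - L r i; pose d' := L r' i - L r' j.
have d0 : 0 < d by rewrite subr_gt0.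
have d'0 : 0 < d' by rewrite subr_gt0.
(* The parameter at which the coordinates i and j on the segment agree. *)
pose t := d / (d + d').
have t01 : 0 <= t <= 1.
  have dd0 : 0 < d + d' by rewrite addr_gt0.
  apply/andP; split; first by rewrite divr_ge0 // ltW.
  by rewrite /t ler_pdivrMr // mul1r lerDl ltW.
have [t0 t1] := andP t01.
pose l k := (1 - t) * L r k + t * L r' k.
have [[[lr0 lr1] lrN] qr] := LJ r rJ; have [[[lr'0 lr'1] lr'N] qr'] := LJ r' r'J.
have lC : convex_coef l.
  split=> [k|]; first by rewrite addr_ge0 // mulr_ge0 // subr_ge0.
  by rewrite big_split /= -!mulr_sumr lr1 lr'1 !mulr1 subrK.
have lij : l i = l j.
  have dd : d + d' != 0 by rewrite gt_eqF // addr_gt0.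
  have Er : L r j = L r i + d by rewrite /d addrC subrK.
  have Er' : L r' j = L r' i - d' by rewrite /d' opprB addrC subrK.
  by rewrite /l Er Er' /t; field.
apply: (Smin (replace s j (midpoint (s i, s j))) (replaced l i j) (J :\ i)).
- exact: bisect_replace.
- split; first by apply: replaced_coef; rewrite ?lij.
  move=> k; rewrite in_setD1 negb_and negbK /replaced.
  case: eqP => [_ _|_ /=]; first by rewrite lij subrr.
  case: eqP => [->|_ kJ]; first by rewrite jJ.
  by rewrite /l lrN // lr'N // !mulr0 addr0.
- by rewrite [in ltnRHS](cardsD1 i) iJ.
rewrite sum_replaced //.
have -> : \sum_k l k *: s k = (1 - t) *: q r + t *: q r'.
  rewrite qr qr' !scaler_sumr -big_split; apply: eq_bigr => k _ /=.
  by rewrite /l scalerDl !scalerA.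
by apply: B_convex => //; apply: qB.
Qed.

Lemma tracked_bisect S s L a b : complex S -> is_edge S (a, b) ->
  no_smaller_face (bisect S (midpoint (a, b))) -> tracked S s L ->
  (exists s', [/\ tracked (bisect S (midpoint (a, b))) s' L, {in J, s' =1 s}
     & forall p r, p \in J -> r \in J -> p != r ->
         ~~ same_edge (a, b) (s p, s r)]) \/
  (exists s' L', tracked (bisect S (midpoint (a, b))) s' L' /\
     `|\det L'| = 2 * `|\det L|).
Proof.
move=> SK ab Smin tr; have [Ss LJ LN] := tr; have [_ SI _] := SK.
have [sw|sw] := pselect (hull s (midpoint (a, b))); last first.
  left; exists s; split=> //; first by split=> //; apply: bisect_kept.
  move=> p r pJ rJ pr; apply/negP => /orP[] /eqP[Ea Eb]; apply: sw.
    by rewrite Ea Eb; apply: hull_midpoint.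
  by rewrite Ea Eb; apply: hull_midpoint; rewrite eq_sym.
have [i [j [ij ia jb]]] := hull_edge SK ab Ss sw.
have ji : j != i by rewrite eq_sym.
rewrite -{}ia -{}jb in ab Smin sw *.
have [jJ|jJ] := boolP (j \in J); last by left; apply: tracked_outside (SI _ Ss) ij jJ.
have [iJ|iJ] := boolP (i \in J); last first.
  have [s' [s'tr s's s'N]] := tracked_outside tr (SI _ Ss) ji iJ.
  left; exists s'; rewrite midpointC; split=> // p r pJ rJ pr.
  have := s'N r p rJ pJ; rewrite eq_sym pr => /(_ isT).
  by rewrite /same_edge /= !xpair_eqE (andbC (s j == s r)) (andbC (s j == s p)).
right; have [Lij|Lji] := tracked_side tr ij iJ jJ Smin; first exact: tracked_inside.
by rewrite midpointC; apply: tracked_inside.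
Qed.

End Tracking.

(** * Finite sets and unordered edges *)

Lemma finite_nat_bound (T : choiceType) (A : set T) (g : T -> nat) :
  finite_set A -> exists N, forall v, A v -> (g v <= N)%N.
Proof.
move=> /finite_seqP[s ->]; exists (\max_(v <- s) g v)%N => v /= vs.
exact: leq_bigmax_seq.
Qed.

Lemma finite_pigeonhole (T : choiceType) (A : set T) (f : nat -> T) :
  finite_set A -> (forall k, A (f k)) ->
  exists v, forall k0, exists2 k, (k0 <= k)%N & f k = v.
Proof.
move=> Afin fA; apply: contrapT => /forallNP fN.
have /choice[g gN] v : exists k0, forall k, (k0 <= k)%N -> f k <> v.
  have /existsNP[k0 /forall2NP H] := fN v; exists k0 => k kk0.
  by case: (H k).
have [N gB] := finite_nat_bound g Afin.
by apply: (gN (f N) N) => //; apply: gB.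
Qed.

Section SameEdge.
Context {R : realType} {n : nat}.
Implicit Types x y z : 'rV[R]_n * 'rV[R]_n.

Lemma same_edgexx x : same_edge x x.
Proof. by rewrite /same_edge eqxx. Qed.

Lemma same_edge_sym x y : same_edge x y = same_edge y x.
Proof.
case: x y => [a b] [a' b']; rewrite /same_edge /= !xpair_eqE.
by rewrite !(eq_sym a') !(eq_sym b') (andbC (b == a')).
Qed.

Lemma same_edge_trans x y z : same_edge x y -> same_edge y z -> same_edge x z.
Proof.
case: x y z => [a b] [a' b'] [a'' b''] /orP[] /eqP[-> ->] // /orP[] /eqP[-> ->];
  by rewrite /same_edge !eqxx ?orbT.
Qed.

Lemma same_edge_congr x y z : same_edge x y -> same_edge z x = same_edge z y.
Proof.
move=> xy; apply/idP/idP => H; first exact: same_edge_trans H xy.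
by apply: same_edge_trans H _; rewrite same_edge_sym.
Qed.

Lemma enorm_gt0 (u : 'rV[R]_n) : u != 0 -> 0 < enorm u.
Proof.
move=> u0; rewrite sqrtr_gt0 lt0r sumr_ge0 ?andbT; last by move=> i _; apply: sqr_ge0.
apply: contra u0; rewrite psumr_eq0 => [/allP H|i _]; last exact: sqr_ge0.
apply/eqP/rowP => i; rewrite mxE; apply/eqP; rewrite -sqrf_eq0.
by apply: H; rewrite mem_index_enum.
Qed.

Lemma enormN (u : 'rV[R]_n) : enorm (- u) = enorm u.
Proof. by congr Num.sqrt; apply: eq_bigr => i _; rewrite mxE sqrrN. Qed.

Lemma same_edge_enorm x y : same_edge x y -> enorm (x.1 - x.2) = enorm (y.1 - y.2).
Proof. by case/orP => /eqP -> //=; rewrite -enormN opprB. Qed.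

End SameEdge.

(** * Found costs and dispersion along an execution *)

Section Run.
Context {R : realType} {n eta : nat} {P : mrpd R n}.
Variables (omega : 'I_eta -> outcome P) (sol : 'rV[R]_n -> policy P) (Delta : R).
Hypothesis eta_gt0 : (0 < eta)%N.
Hypothesis sol_correct : solver_correct sol.
Hypothesis balls : forall c, optimal_solutions omega c ->
  exists (Wc : set 'rV[R]_n) (r : R),
    [/\ Wc `<=` @weights R n, forall w, Wc w -> optimal_for omega c w,
        0 < r & inscribes_ball Wc r].
Hypothesis separated : forall c c', optimal_solutions omega c ->
  optimal_solutions omega c' -> c <> c' -> distinct Delta c c'.
Variables (st : nat -> state R n eta) (x : nat -> 'rV[R]_n * 'rV[R]_n).
Let C w := training_costs omega (sol w).
Hypothesis run : execution Delta C st x.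
Hypothesis ties : fair Delta C st x.

Let S k := simplexes (st k).

Lemma C_optimal w : weights w -> optimal_for omega (C w) w.
Proof. by move=> wW; exists (sol w); split=> // l; apply: sol_correct. Qed.

Lemma C_solution w : weights w -> optimal_solutions omega (C w).
Proof. by move=> wW; exists w => //; apply: C_optimal. Qed.

Lemma solution_box c : optimal_solutions omega c ->
  exists (y : 'rV[R]_n) d,
    [/\ 0 < d, weights y & box y d `<=` optimal_for omega c].
Proof.
move=> /balls[Wc [r [WcW Wopt r0 /(inscribed_box r0)[y [d [d0 y1 yW]]]]]].
exists y, d; split=> // [|w /yW /Wopt //].
by apply/WcW/yW; split; rewrite ?subrr ?normr0.
Qed.

Lemma solution_mean_inj c c' : optimal_solutions omega c ->
  optimal_solutions omega c' -> mean c = mean c' -> c = c'.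
Proof.
move=> /solution_box[y [d [d0 [_ y1] yB]]] [w' _ c'w'].
exact: mean_inj eta_gt0 d0 y1 yB c'w'.
Qed.

Lemma x_edge k : is_edge (S k) (x k).
Proof. by case: run => _ /(_ k)[[]]. Qed.

Lemma S_next k : S k.+1 = bisect (S k) (midpoint (x k)).
Proof. by case: run => _ /(_ k)[_]; rewrite /S => ->. Qed.

Lemma S_complex k : complex (S k).
Proof.
elim: k => [|k IH]; first by rewrite /S; case: run => -> _; exact: complex_initial.
by rewrite S_next; have := x_edge k; case: (x k) => a b; apply: complex_bisect.
Qed.

Lemma edge_weights k y : is_edge (S k) y -> weights y.1 /\ weights y.2.
Proof.
have [SW _ _] := S_complex k.
by move=> [s [i [j [/SW sW _ ->]]]]; split; apply: sW.
Qed.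

Lemma midpoint_weights k y : is_edge (S k) y -> weights (midpoint y).
Proof.
have [SW _ _] := S_complex k; move=> [s [i [j [/SW sW ij ->]]]].
by rewrite /midpoint /= -sum_half //; have [h0 h1] := half_coef ij (R := R);
  apply: weights_convex.
Qed.

Lemma Gamma_mono j k : (j <= k)%N -> Gamma (st j) `<=` Gamma (st k).
Proof.
move=> /subnK <-; elim: (k - j)%N => [|i IH] // c /IH; rewrite addSn.
by case: run => _ /(_ (i + j)%N)[_ ->]; left.
Qed.

(** By [separated], a midpoint with costs outside [Gamma] passes the overlap test against all of
    [Omega]; so a rejected midpoint has costs found before. *)
Lemma found k : (forall w, Omega (st k) w -> weights w /\ Gamma (st k) (C w)) /\
  (forall s i, S k s -> Gamma (st k) (C (s i))).
Proof.
elim: k => [|k [IHO IHS]].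
  rewrite /S; case: run => -> _; split=> [_ [i _ <-]|s i ->].
    by split; [exact: delta_weights | exists i].
  by rewrite ffunE; exists i.
have stE : st k.+1 = Defs.next Delta C (st k) (x k) by case: run => _ /(_ k)[].
have wW := midpoint_weights (x_edge k).
have mono := Gamma_mono (leqnSn k).
have new : Gamma (st k.+1) (C (midpoint (x k))).
  have [Gw|Gw] := pselect (Gamma (st k) (C (midpoint (x k)))); first exact: mono.
  rewrite stE; right; exists (midpoint (x k)) => //; split=> // v Ov.
  have [vW Gv] := IHO v Ov.
  apply: separated; [exact: C_solution|exact: C_solution|].
  by move=> E; rewrite E in Gw.
split=> [w|t i].
  by rewrite {1}stE => -[/IHO[wwW /mono]|[-> _]].
have := x_edge k; have := S_complex k; rewrite S_next.
move: new; case: (x k) => a b new SK ab /(bisectP SK ab).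
move=> [[St _]|[s [p [q [Ss _ _ _ ->]]]]]; first exact/mono/IHS.
by rewrite ffunE; case: eqP => // _; exact/mono/IHS.
Qed.

Definition picks v k : nat :=
  count (fun y => same_edge (mean_edge C y) v) (returned (st k)).

Lemma picksS v k : picks v k.+1 = (same_edge (mean_edge C (x k)) v + picks v k)%N.
Proof. by rewrite /picks; case: run => _ /(_ k)[_ ->]. Qed.

Lemma picks_mono v j k : (j <= k)%N -> (picks v j <= picks v k)%N.
Proof.
move=> /subnK <-; elim: (k - j)%N => [|i IH] //.
by rewrite addSn picksS (leq_trans IH) // leq_addl.
Qed.

Lemma dispersion_le k y : dispersion Delta C (st k) y <=
  enorm ((mean_edge C y).1 - (mean_edge C y).2) / 2 ^+ picks (mean_edge C y) k.
Proof.
rewrite /dispersion -/(picks _ _) [leLHS]mulrC.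
rewrite ler_wpM2l ?sqrtr_ge0 // ler_pdivrMr ?exprn_gt0 // mulVf ?expf_neq0 //.
by case: distinct.
Qed.

Lemma dispersion_mixed k y : weights y.1 -> weights y.2 -> C y.1 <> C y.2 ->
  dispersion Delta C (st k) y =
  enorm ((mean_edge C y).1 - (mean_edge C y).2) / 2 ^+ picks (mean_edge C y) k.
Proof.
move=> y1 y2 yC; rewrite /dispersion -/(picks _ _) separated //; last first.
- exact: C_solution.
- exact: C_solution.
by rewrite mul1r mulrC.
Qed.

Lemma mixed_mean_gt0 y : weights y.1 -> weights y.2 -> C y.1 <> C y.2 ->
  0 < enorm ((mean_edge C y).1 - (mean_edge C y).2).
Proof.
move=> y1 y2 yC; apply: enorm_gt0; rewrite subr_eq0; apply/eqP => E; apply: yC.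
exact: (solution_mean_inj (C_solution y1) (C_solution y2)).
Qed.

(* Otherwise the dispersion of [y] stays constant, whereas that of the picked
   edges tends to 0 since their mean costs take finitely many values. *)
Lemma persistent_max k0 y : C y.1 <> C y.2 ->
  (forall k, (k0 <= k)%N -> is_edge (S k) y) ->
  forall k1, exists2 k, (k1 <= k)%N & max_edge Delta C (st k) y.
Proof.
move=> yC yS k1; apply: contrapT => yN.
have [y1 y2] := edge_weights (yS k0 (leqnn _)).
pose k2 := maxn k0 k1.
have notmax k : (k2 <= k)%N -> ~ max_edge Delta C (st k) y.
  by rewrite geq_max => /andP[_ kk1] ymax; apply: yN; exists k.
have xmax k z : is_edge (S k) z ->
    dispersion Delta C (st k) z <= dispersion Delta C (st k) (x k).
  by case: run => _ /(_ k)[[_ +] _]; apply.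
(* An edge with the mean costs of [y] has the same [alpha], so if it were picked, [y] would be a
   maximizer too. *)
have yx k : (k2 <= k)%N -> ~~ same_edge (mean_edge C (x k)) (mean_edge C y).
  move=> k2k; apply/negP => xy; apply: (notmax k k2k); split.
    by apply: yS; move: k2k; rewrite geq_max => /andP[].
  move=> z /xmax H; apply: le_trans H _; apply: le_trans (dispersion_le _ _) _.
  rewrite dispersion_mixed // (same_edge_enorm xy) /picks.
  by rewrite (eq_count (fun z => same_edge_congr (mean_edge C z) xy)).
have picksy k : (k2 <= k)%N -> picks (mean_edge C y) k = picks (mean_edge C y) k2.
  move=> /subnK <-; elim: (k - k2)%N => [|i IH] //.
  by rewrite addSn picksS IH (negbTE (yx _ _)) // leq_addl.
pose D := dispersion Delta C (st k2) y.
have D0 : 0 < D by rewrite /D dispersion_mixed // divr_gt0 ?exprn_gt0 ?mixed_mean_gt0.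
have xD k : (k2 <= k)%N -> D <= dispersion Delta C (st k) (x k).
  move=> k2k; apply: le_trans (xmax _ _ (yS k _)).
    by rewrite /D !dispersion_mixed // picksy.
  by move: k2k; rewrite geq_max => /andP[].
have Gfin := finite_optimal_solutions omega.
have [v vinf] : exists v, forall j, exists2 k, (j <= k)%N & mean_edge C (x k) = v.
  apply: (finite_pigeonhole
    (A := (@mean R n eta @` optimal_solutions omega) `*`
          (@mean R n eta @` optimal_solutions omega))).
    by apply: finite_setX; apply: finite_image.
  move=> k; have [/C_solution ? /C_solution ?] := edge_weights (x_edge k).
  by split; [exists (C (x k).1)|exists (C (x k).2)].
have vpicks N : exists k,
    [/\ (k2 <= k)%N, mean_edge C (x k) = v & (N <= picks v k)%N].
  elim: N => [|N [k [k2k xv Nk]]]; first by have [k ? ?] := vinf k2; exists k.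
  have [k' kk' xv'] := vinf k.+1; exists k'; split=> //.
    exact: leq_trans k2k (ltnW kk').
  apply: leq_trans (picks_mono _ kk'); rewrite picksS xv same_edgexx add1n.
  by rewrite ltnS.
pose M := enorm (v.1 - v.2).
(* After N picks of the mean costs [v] the dispersion is at most M / 2^N; the weaker bound M / N
   already contradicts the Archimedean property. *)
have DM N : D * N%:R <= M.
  have [k [k2k xv Nk]] := vpicks N.
  have := le_trans (xD k k2k) (dispersion_le k (x k)); rewrite xv -/M.
  rewrite ler_pdivlMr ?exprn_gt0 //; apply: le_trans.
  rewrite ler_pM2l // -natrX ler_nat (leq_trans Nk) // ltnW //.
  exact: ltn_expl.
have := archi_boundP (divr_ge0 (sqrtr_ge0 _ : 0 <= M) (ltW D0)).
by rewrite ltr_pdivrMr // mulrC ltNge DM.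
Qed.

(** * No face meets the ball of a solution that is never found *)

Section Unfound.
Variables (c : costs R n eta) (y : 'rV[R]_n) (d : R).
Hypothesis yB : box y d `<=` optimal_for omega c.
Hypothesis unfound : forall k, ~ Gamma (st k) c.

(** The induction on [#|J|] treats all times at once, so that the induction hypothesis is the
    minimality needed by [tracked_bisect] at every later time. *)
Lemma face_avoids_box k s l (J : {set 'I_n}) : S k s -> supported J l ->
  ~ box y d (\sum_j l j *: s j).
Proof.
have [N cardJ] := ubnP #|J|; elim: N => // N IH in k s l J cardJ *.
move=> Ss lJ pB.
set p := \sum_j l j *: s j in pB.
have [e [e0 e1 eB]] := box_open pB.
pose q r := p + e *: (s r - p).
have qB r : r \in J -> box y d (q r).
  have [SW _ _] := S_complex k.
  by move=> _; apply: eB; [exact: SW | rewrite gtr0_norm].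
have small j : no_smaller_face (box y d) J (S j).
  move=> s' l' A Ss' lA AJ; apply: IH Ss' lA.
  by rewrite ltnS in cardJ; exact: leq_trans AJ cardJ.
have B_convex := @box_segment _ _ y d.
have [L0 tr0 detL0] := det0_tracked Ss lJ (erefl p) e0 e1 (fun r _ => erefl (q r)).
pose tr k := tracked J q (S k).
have step j s' L : tr j s' L ->
    (exists s'', [/\ tr j.+1 s'' L, {in J, s'' =1 s'}
       & forall p r, p \in J -> r \in J -> p != r ->
           ~~ same_edge (x j) (s' p, s' r)]) \/
    (exists s'' L', tr j.+1 s'' L' /\ `|\det L'| = 2 * `|\det L|).
  rewrite /tr S_next => trj; have := small j.+1; rewrite S_next.
  have := x_edge j; case: (x j) => a b ab Smin.
  exact: (tracked_bisect B_convex qB (S_complex j) ab Smin trj).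
(* A tracked matrix whose determinant is never doubled exists, as endless doubling would exceed the
   bound of [det_bound]. *)
have [k1 [s1 [L1 [tr1 last1]]]] : exists k1 s1 L1, tr k1 s1 L1 /\
    forall j s' L', tr j s' L' -> `|\det L'| <> 2 * `|\det L1|.
  apply: contrapT => noL.
  have double j s' L' : tr j s' L' ->
      exists j' s'' L'', tr j' s'' L'' /\ `|\det L''| = 2 * `|\det L'|.
    move=> trj; apply: contrapT => noL'; apply: noL; exists j, s', L'; split=> //.
    by move=> j' s'' L'' trj' detL''; apply: noL'; exists j', s'', L''.
  have grow m : exists j s' L', tr j s' L' /\ m.+1%:R * `|\det L0| <= `|\det L'|.
    elim: m => [|m [j [s' [L' [/double[j' [s'' [L'' [trj' E]]]] mL']]]]].
      by exists k, s, L0; rewrite mul1r.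
    exists j', s'', L''; split=> //; rewrite E.
    have m0 : 0 <= m%:R :> R := ler0n _ _.
    have D0 : 0 <= `|\det L0| by [].
    move: mL'; rewrite -!natr1; nra.
  have detL0_gt0 : 0 < `|\det L0| by rewrite normr_gt0.
  have fact_ge0 : 0 <= (n`!)%:R / `|\det L0| by rewrite divr_ge0.
  have [j [s' [L' [[_ L'J L'N] L'gt]]]] := grow (Num.bound ((n`!)%:R / `|\det L0|)).
  have : `|\det L'| <= (n`!)%:R.
    apply: det_bound => a b; have [aJ|aJ] := boolP (a \in J).
      have [[[L'0 L'1] _] _] := L'J a aJ; rewrite L'0 -L'1 (bigD1 b) //= lerDl.
      by rewrite sumr_ge0.
    by rewrite L'N //; case: eqP; rewrite ?lexx ?ler01.
  have := archi_boundP fact_ge0; rewrite ltr_pdivrMr // => nlt L'n.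
  move: nlt L'gt; rewrite -natr1 mulrDl mul1r; lra.
have stay i : exists s', tr (i + k1)%N s' L1 /\ {in J, s' =1 s1}.
  elim: i => [|i [s' [tri s's1]]]; first by exists s1.
  case: (step _ _ _ tri) => [[s'' [tr'' s''s' _]]|[s'' [L' [tr'' detL']]]].
    by exists s''; split=> // r rJ; rewrite s''s' // s's1.
  by case: (last1 _ _ _ tr'' detL').
have [Ss1 L1J L1N] := tr1.
have [r0 r0J] : exists r, r \in J.
  apply: contrapT => /forallNP JN; have [[l0 l1] lN] := lJ.
  move/eqP: l1; rewrite big1 ?(eq_sym 0) ?oner_eq0 // => j _.
  by apply: lN; apply/negP/JN.
have [SW1 _ _] := S_complex k1.
(* If all costs on the face were equal, they would be optimal at [q r0] by convexity and equal to
   [c] by uniqueness in the box; but costs of vertices are found. *)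
have [r [rJ Cr]] : exists r, r \in J /\ C (s1 r0) <> C (s1 r).
  apply: contrapT => /forallNP same.
  have Cs1 r : r \in J -> C (s1 r) = C (s1 r0).
    by move=> rJ; apply: contrapT => Cr; apply: (same r); split=> // E; apply: Cr.
  have [[[L0r L1r] LNr] qr] := L1J r0 r0J.
  apply: (unfound (k := k1)); rewrite -(optimal_unique (w := q r0) (c' := C (s1 r0)) yB).
  - by have [_] := found k1; apply.
  - exact: qB.
  - rewrite qr; apply: optimal_convex => // j Lj.
    have [jJ|jJ] := boolP (j \in J); last by rewrite LNr // eqxx in Lj.
    by rewrite -(Cs1 j) //; apply: C_optimal; apply: SW1.
have r0r : r0 != r by apply/eqP => E; rewrite E in Cr.
have edge_stays j : (k1 <= j)%N -> is_edge (S j) (s1 r0, s1 r).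
  move=> /subnK <-; have [s' [[Ss' _ _] s's1]] := stay (j - k1)%N.
  by exists s', r0, r; rewrite !s's1.
(* Fairness picks this edge, yet a step without doubling bisects no edge of the face. *)
have [j k1j xj] := ties k1 (persistent_max (y := (s1 r0, s1 r)) Cr edge_stays).
have [s' [trj s's1]] := stay (j - k1)%N; rewrite subnK // in trj.
case: (step _ _ _ trj) => [[s'' [_ _ /(_ r0 r r0J rJ r0r)]]|[s'' [L' [tr'' detL']]]].
  by rewrite !s's1 // xj.
by case: (last1 _ _ _ tr'' detL').
Qed.

End Unfound.

(** In the initial simplex, the coordinates of the centre [y] are its entries, so the full face
    meets the box. *)
Lemma eventually_found c : optimal_solutions omega c -> exists k, Gamma (st k) c.
Proof.
move=> /solution_box[y [d [d0 yW yB]]]; apply: contrapT => /forallNP unfound.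
have yby : box y d y by case: yW => _ y1; split; rewrite ?subrr ?normr0.
have S0 : S 0 [ffun i => delta_mx 0 i] by rewrite /S; case: run => -> _.
have yS : supported [set: 'I_n]%SET (y 0) by split=> // j; rewrite inE.
apply: (face_avoids_box yB unfound S0 yS).
suff -> : \sum_j y 0 j *: [ffun i : 'I_n => delta_mx 0 i : 'rV[R]_n] j = y by [].
by rewrite [RHS]row_sum_delta; apply: eq_bigr => j _; rewrite ffunE.
Qed.

End Run.

Theorem theorem1 (R : realType) (n eta : nat) (P : mrpd R n)
    (omega : 'I_eta -> outcome P) (sol : 'rV[R]_n -> policy P) (Delta : R)
    (eta_gt0 : (0 < eta)%N)
    (sol_correct : solver_correct sol)
    (balls : forall c, optimal_solutions omega c ->
       exists (Wc : set 'rV[R]_n) (r : R),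
         [/\ Wc `<=` @weights R n, forall w, Wc w -> optimal_for omega c w,
             0 < r & inscribes_ball Wc r])
    (separated : forall c c', optimal_solutions omega c ->
       optimal_solutions omega c' -> c <> c' -> distinct Delta c c')
    (st : nat -> state R n eta) (x : nat -> 'rV[R]_n * 'rV[R]_n)
    (run : execution Delta (fun w => training_costs omega (sol w)) st x)
    (ties : fair Delta (fun w => training_costs omega (sol w)) st x) :
  exists K0 : nat, forall K : nat, (K0 <= K)%N ->
    optimal_solutions omega `<=` returned_costs st K.
Proof.
have /choice[g gP] c : exists k, optimal_solutions omega c -> Gamma (st k) c.
  have [cO|cO] := pselect (optimal_solutions omega c); last by exists 0%N.
  have [k kc] := eventually_found eta_gt0 sol_correct balls separated run ties cO.
  by exists k.
have [N gN] := finite_nat_bound g (finite_optimal_solutions omega).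
(* All solutions are found by time [N], and the budget [K] returns the state number [K.+1 - n]. *)
exists (N + n)%N => K NK c cO.
apply: (Gamma_mono run _ (gP c cO)); apply: leq_trans (gN c cO) _.
by rewrite -[leqLHS](addnK n) leq_sub2r // leqW.
Qed.
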